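(* Let $\Bbbk$ be a field, let $n\geq 1$, and let $x=(x_1,\ldots,x_n)$. Let $P(Z)\in\Bbbk[[x]][Z]$ be a monic polynomial of degree $d\geq 1$ in $Z$ with $P(Z)\neq Z^d$. Assume that $P(Z)$ is irreducible in $\Bbbk[[x]][Z]$ and that $P$ has an orthant associated polyhedron, i.e. $\Delta_P=d\gamma+\mathbb{R}_{\geq 0}^n$ for some $\gamma\in\mathbb{Q}_{\geq 0}^n$. Then the polynomial $P_{\operatorname{In}}(x,Z)\in\Bbbk[x,Z]$ is not the product of two non-constant coprime polynomials of $\Bbbk[x,Z]$.
   Context: $\Bbbk[[x]]$ is the ring of formal power series in $x_1,\ldots,x_n$ over $\Bbbk$, and $x^\alpha=x_1^{\alpha_1}\cdots x_n^{\alpha_n}$ for $\alpha\in\mathbb{Z}_{\geq 0}^n$. Write $$P(Z)=Z^d+\sum_{\alpha\in\mathbb{Z}_{\geq 0}^n,\ 0\leq j<d}c_{\alpha,j}x^\alpha Z^j,\qquad c_{\alpha,j}\in\Bbbk.$$ The associated polyhedron $\Delta_P\subset\mathbb{R}_{\geq 0}^n$ of $P$ is the convex hull of $$\left\{\frac{d\,\alpha}{d-j}\ \middle|\ c_{\alpha,j}\neq 0,\ j<d\right\}+\mathbb{R}_{\geq 0}^n .$$ If $\Delta_P=d\gamma+\mathbb{R}_{\geq 0}^n$ for some $\gamma\in\mathbb{Q}_{\geq 0}^n$, one says that $P$ has an orthant associated polyhedron, and one sets $$P_{\operatorname{In}}(x,Z):=Z^d+\sum_{(\alpha,j)\,:\,j<d,\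 \frac{\alpha}{d-j}=\gamma}c_{\alpha,j}x^\alpha Z^j\in\Bbbk[x,Z].$$ Two polynomials of $\Bbbk[x,Z]$ are coprime if they have no non-constant common divisor in $\Bbbk[x,Z]$. *)

(* Defs.v *)
From HB Require Import structures.
From mathcomp Require Import all_boot all_order all_algebra.
From mathcomp Require Import boolp classical_sets reals convex mpoly.
Set Implicit Arguments.
Unset Strict Implicit.
Unset Printing Implicit Defensive.
Import Order.TTheory GRing.Theory Num.Theory.
Local Open Scope ring_scope.

Section FormalPowerSeries.
Variables (n : nat) (K : comNzRingType).

Record fps := Fps { fps_coef :> 'X_{1..n} -> K }.

Implicit Types f g h : fps.

Lemma fpsP f g : (forall m, f m = g m) <-> f = g.
Proof.
split=> [|-> //]; case: f; case: g => g f /= efg.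
by congr Fps; apply/funext.
Qed.

HB.instance Definition _ := gen_eqMixin fps.
HB.instance Definition _ := gen_choiceMixin fps.

Definition fps0 := Fps (fun _ => 0).
Definition fps1 := Fps (fun m => (m == 0%MM)%:R).
Definition fps_opp f := Fps (fun m => - f m).
Definition fps_add f g := Fps (fun m => f m + g m).

(* The pairs (k1, k2) with k1 + k2 = m all have degree at most mdeg m, hence
   the finite index type. *)
Definition fps_mul f g := Fps (fun m =>
  \sum_(k : 'X_{1..n < (mdeg m).+1, (mdeg m).+1} | m == (k.1 + k.2)%MM)
     f k.1 * g k.2).

Fact fps_addA : associative fps_add.
Proof. by move=> f g h; apply/fpsP => m /=; rewrite addrA. Qed.

Fact fps_addC : commutative fps_add.
Proof. by move=> f g; apply/fpsP => m /=; rewrite addrC. Qed.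

Fact fps_add0 : left_id fps0 fps_add.
Proof. by move=> f; apply/fpsP => m /=; rewrite add0r. Qed.

Fact fps_addN : left_inverse fps0 fps_opp fps_add.
Proof. by move=> f; apply/fpsP => m /=; rewrite addNr. Qed.

HB.instance Definition _ :=
  GRing.isZmodule.Build fps fps_addA fps_addC fps_add0 fps_addN.

Definition fps_trunc b f : {mpoly K[n]} :=
  \sum_(m : 'X_{1..n < b}) f m *: 'X_[m].

Lemma coef_fps_trunc b f m : (mdeg m < b)%N -> (fps_trunc b f)@_m = f m.
Proof. by move=> ltmb; rewrite /fps_trunc (mcoeff_mpoly f). Qed.

Lemma fps_mul_coef b f g (p q : {mpoly K[n]}) m : (mdeg m < b)%N ->
    (forall k, (mdeg k < b)%N -> p@_k = f k) ->
    (forall k, (mdeg k < b)%N -> q@_k = g k) ->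
  (p * q)@_m = fps_mul f g m.
Proof.
move=> ltmb ep eq; rewrite mcoeffM /=; apply: eq_bigr => -[k1 k2] /= _.
by rewrite ep ?eq //; apply: leq_trans (bmdeg _) ltmb.
Qed.

Lemma fps_mul_trunc b f g m : (mdeg m < b)%N ->
  (fps_trunc b f * fps_trunc b g)@_m = fps_mul f g m.
Proof. by move=> lb; apply: (fps_mul_coef lb) => k; apply: coef_fps_trunc. Qed.

Fact fps_mulA : associative fps_mul.
Proof.
move=> f g h; apply/fpsP => m; have lb := ltnSn (mdeg m).
have tr := @coef_fps_trunc (mdeg m).+1; have trM := @fps_mul_trunc (mdeg m).+1.
have /= <- := fps_mul_coef lb (tr f) (trM g h).
by have /= <- := fps_mul_coef lb (trM f g) (tr h); rewrite mulrA.
Qed.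

Fact fps_mulC : commutative fps_mul.
Proof.
by move=> f g; apply/fpsP=> m; rewrite -!(fps_mul_trunc _ _ (ltnSn _)) mulrC.
Qed.

Fact fps_mul1 : left_id fps1 fps_mul.
Proof.
move=> f; apply/fpsP => m; have lb := ltnSn (mdeg m).
have tr := @coef_fps_trunc (mdeg m).+1.
have tr1 k : (mdeg k < (mdeg m).+1)%N -> (1 : {mpoly K[n]})@_k = fps1 k.
  by rewrite mcoeff1.
by have /= <- := fps_mul_coef lb tr1 (tr f); rewrite mul1r tr.
Qed.

Fact fps_mulD : left_distributive fps_mul fps_add.
Proof.
move=> f g h; apply/fpsP => m; have lb := ltnSn (mdeg m).
have tr := @coef_fps_trunc (mdeg m).+1.
set b := (mdeg m).+1 in lb tr.
have trD k : (mdeg k < b)%N ->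
    (fps_trunc b f + fps_trunc b g)@_k = fps_add f g k.
  by move=> lk; rewrite mcoeffD !tr.
have /= <- := fps_mul_coef lb trD (tr h).
by rewrite mulrDl mcoeffD !fps_mul_trunc.
Qed.

Fact fps_oneNzero : fps1 != 0.
Proof.
apply/eqP => /fpsP/(_ 0%MM) /= /eqP.
by rewrite eqxx oner_eq0.
Qed.

HB.instance Definition _ := GRing.Zmodule_isComNzRing.Build fps
  fps_mulA fps_mulC fps_mul1 fps_mulD fps_oneNzero.

End FormalPowerSeries.

Section Irreducible.
Variable A : comNzRingType.

Definition invertible (a : A) : Prop := exists b, a * b = 1.

(* Irreducibility as an element of the ring; irreducible_poly is not suitable
   over coefficient rings that are not fields, since it ignores non-invertible
   constant factors. *)
Definition irreducible (p : A) : Prop :=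
  [/\ p <> 0, ~ invertible p &
      forall a b, p = a * b -> invertible a \/ invertible b].

End Irreducible.

Section Polyhedron.
Variables (R : realType) (n : nat).

Local Open Scope classical_set_scope.

Definition convex_hull (A : set 'rV[R]_n) : set 'rV[R]_n :=
  smallest (@convex_set R 'rV[R]_n) A.

Definition orthant : set 'rV[R]_n := [set v | forall i, 0 <= v ord0 i].

Definition minkowski_sum (A B : set 'rV[R]_n) : set 'rV[R]_n :=
  [set u + v | u in A & v in B].

Variable K : fieldType.
Implicit Type P : {poly (fps n K)}.

(* In the definitions below d is meant to be the degree of the monic P. *)
Definition scaled_exponents d P : set 'rV[R]_n :=
  [set v | exists (j : nat) (a : 'X_{1..n}),
     [/\ (j < d)%N, P`_j a != 0 &
         v = \row_i (d%:R * (a i)%:R / (d - j)%:R)]].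

Definition associated_polyhedron d P : set 'rV[R]_n :=
  convex_hull (minkowski_sum (scaled_exponents d P) orthant).

Definition orthant_associated_polyhedron d P (gamma : 'I_n -> rat) : Prop :=
  (forall i, 0 <= gamma i) /\
  associated_polyhedron d P =
    minkowski_sum [set \row_i (d%:R * ratr (gamma i))] orthant.

End Polyhedron.

Section InitialForm.
Variables (n : nat) (K : fieldType).

Definition on_slope d (gamma : 'I_n -> rat) (j : nat) (a : 'X_{1..n}) : bool :=
  [forall i, (a i)%:R / (d - j)%:R == gamma i].

Definition slope_bound d (gamma : 'I_n -> rat) : nat :=
  (\sum_i Num.truncn (d%:R * gamma i)).+1.

(* K[x, Z] is {poly {mpoly K[n]}}. By on_slope_bound below, the degree bound on
   the exponents a only serves to make the index type finite. *)
Definition initial_form d (gamma : 'I_n -> rat) (P : {poly (fps n K)}) :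
    {poly {mpoly K[n]}} :=
  'X^d + \sum_(j < d)
     \sum_(a : 'X_{1..n < slope_bound d gamma} | on_slope d gamma j a)
        (P`_j a *: 'X_[a]) *: 'X^j.

Lemma on_slope_bound d gamma j a :
  (j < d)%N -> on_slope d gamma j a -> (mdeg a < slope_bound d gamma)%N.
Proof.
move=> ltjd /forallP sl; rewrite ltnS mdegE; apply: leq_sum => i _.
have dj0 : (0 : rat) < (d - j)%:R by rewrite ltr0n subn_gt0.
have ai : (a i)%:R = gamma i * (d - j)%:R.
  by rewrite -(eqP (sl i)) divfK // gt_eqF.
have g0 : 0 <= gamma i by rewrite -(eqP (sl i)) divr_ge0 // ler0n.
rewrite -(natrK (R := rat) (a i)); apply: le_truncn.
by rewrite ai mulrC ler_wpM2r // ler_nat leq_subr.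
Qed.

Lemma coef_initial_form d gamma P j a :
  (initial_form d gamma P)`_j@_a =
    if (j < d)%N then (if on_slope d gamma j a then P`_j a else 0)
    else ((j == d) && (a == 0%MM))%:R.
Proof.
rewrite coefD mcoeffD coefXn coef_sum raddf_sum /= mcoeffMn mcoeff1.
have term (i : 'I_d) :
    (\sum_(b : 'X_{1..n < slope_bound d gamma} | on_slope d gamma i b)
        (P`_i b *: 'X_[b]) *: 'X^i : {poly {mpoly K[n]}})`_j@_a =
    if i == j :> nat then (if on_slope d gamma j a then P`_j a else 0) else 0.
  rewrite coef_sum raddf_sum /=; case: (eqVneq (i : nat) j) => [eij|nij].
    under eq_bigr => b _ do
      rewrite coefZ coefXn eij eqxx mulr1 mcoeffZ mcoeffX.
    have ltjd : (j < d)%N by rewrite -eij.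
    rewrite eij; case: ifP => sl.
      rewrite (bigD1 (BMultinom (on_slope_bound ltjd sl))) //= eqxx mulr1.
      rewrite big1 ?addr0 // => b /andP[_ /negPf nb].
      by rewrite -[bmnm b == a]/(b == BMultinom (on_slope_bound ltjd sl)) nb mulr0.
    rewrite big1 // => b slb; case: eqP => [eb|]; last by rewrite mulr0.
    by rewrite -eb slb in sl.
  by rewrite big1 // => b _; rewrite coefZ coefXn eq_sym (negPf nij) mulr0 mcoeff0.
under eq_bigr => i _ do rewrite term.
case: ltnP => [ltjd|ledj].
  rewrite ltn_eqF // mulr0n add0r (bigD1 (Ordinal ltjd)) //= eqxx big1 ?addr0 //.
  by move=> i; rewrite -val_eqE /= => /negPf ->.
rewrite big1 ?addr0 => [|i _]; last first.
  by rewrite ltn_eqF // (leq_trans (ltn_ord i)).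
by case: (j == d); case: (a == _).
Qed.

Definition is_constant (f : {poly {mpoly K[n]}}) : Prop :=
  exists c : K, f = (c%:MP)%:P.

(* polydiv's %| is pseudo-division, which differs from divisibility in
   K[x][Z]. *)
Definition divides (f g : {poly {mpoly K[n]}}) : Prop :=
  exists h, g = h * f.

Definition coprime_poly (f g : {poly {mpoly K[n]}}) : Prop :=
  forall h, divides h f -> divides h g -> is_constant h.

End InitialForm.

(* Main.v *)
(* Choose m > 0 and g with g = m * gamma integral.  Substituting x_i = y_i^m and
   Z = y^g W turns P into y^(d g) Q(y, W) with Q(0, W) = P_In(1, W) =: f, and
   P_In into y^(d g) f(W); as K[W][y] is a domain, each factor of P_In then
   becomes a monomial in y times a factor of f.  The image of the substitution
   consists of the series that are homogeneous for the (Z/m)^n-grading in which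
   y_i has degree e_i and W has degree -g.  The gcd of two homogeneous
   polynomials of K[W] is homogeneous, so it comes from a common divisor in
   K[x, Z]; hence coprime factors A, B of P_In give coprime factors a, b of f.
   Hensel's lemma lifts f = a b to Q = F G over K[[y]], the corrections can be
   kept homogeneous, and so F and G come from a factorisation of P. *)

Require Import Defs.
From HB Require Import structures.
From mathcomp Require Import all_boot all_order all_algebra.
From mathcomp Require Import boolp classical_sets reals convex mpoly.
From mathcomp Require Import zify.
Import Order.TTheory GRing.Theory Num.Theory.
Local Open Scope ring_scope.

Set Implicit Arguments.
Unset Strict Implicit.
Unset Printing Implicit Defensive.

(** * Factors of a monomial over a domain *)

(** Over a domain neither the product of the leading terms nor that of the last terms can cancel, so
    both sit at [N]. As [mlast] is at most [mlead] in each factor, the two coincide in [p]. *)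
Lemma mpoly_mul_monomial (n : nat) (D : idomainType) (p q : {mpoly D[n]}) N :
    p * q != 0 -> (forall u, (p * q)@_u != 0 -> u = N) ->
  exists N1, forall u, p@_u != 0 -> u = N1.
Proof.
move=> pq0 suppN; have [p0 q0]: p != 0 /\ q != 0.
  by apply/andP; rewrite -negb_or -mulf_eq0.
have lead_N : (mlead p + mlead q)%MM = N.
  by apply: suppN; rewrite mleadcM mulf_neq0 // mleadc_eq0.
(* Any other pair of support exponents has a strictly larger sum, so this coefficient is a single
   product of nonzero elements. *)
have last_N : (mlast p + mlast q)%MM = N.
  apply: suppN; rewrite mpolyME (bigD1_seq (mlast p, mlast q)) /=; first last.
  - by rewrite allpairs_uniq // => -[? ?] [].
  - by rewrite allpairs_f ?mlast_supp.
  rewrite mcoeffD mcoeffZ mcoeffX eqxx mulr1 big_seq_cond raddf_sum /= big1.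
    by rewrite addr0 mulf_neq0 // -mcoeff_msupp mlast_supp.
  case=> m1 m2; rewrite ssrcomplements.in_allpairs; last first.
    exact: ssrcomplements.prod_inj.
  rewrite -?andbA => /and3P[m1p m2q neq].
  rewrite mcoeffZ mcoeffX; case: eqP => [e|]; last by rewrite mulr0.
  have := mlast_lemc m1p; have := mlast_lemc m2q.
  rewrite le_eqVlt => /predU1P[e2|lt2] le1; last first.
    by have := lemc_lt_add le1 lt2; rewrite e ltxx.
  move: e neq; rewrite e2 /= => /addIm ->.
  by rewrite eqxx.
have eq_lead : mlast p = mlead p.
  have lep := mlast_lemc (mlead_supp p0).
  have leq := mlast_lemc (mlead_supp q0).
  move: lep; rewrite le_eqVlt => /predU1P[//|lt1].
  by have := ltmc_le_add lt1 leq; rewrite lead_N last_N ltxx.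
exists (mlead p) => u; rewrite -mcoeff_msupp => up; apply/le_anti.
by rewrite msupp_le_mlead // -eq_lead mlast_lemc.
Qed.

(** * The substitution x_i = y_i^m, Z = y^g W on polynomials *)

Section WeightedSubstitution.
Variables (K : fieldType) (n m : nat) (g : 'X_{1..n}).
Hypothesis m_gt0 : (0 < m)%N.

(* The exponent of y in the image of x^a Z^j under x_i = y_i^m, Z = y^g W. *)
Definition wt (a : 'X_{1..n}) (j : nat) : 'X_{1..n} := (a *+ m + g *+ j)%MM.

Lemma wtE a j i : wt a j i = (m * a i + j * g i)%N.
Proof. by rewrite mnmDE !mulmnE !(mulnC m) (mulnC j). Qed.

Lemma wtD a b j k : wt (a + b)%MM (j + k) = (wt a j + wt b k)%MM.
Proof.
by apply/mnmP => i; rewrite mnmDE !wtE mnmDE !mulnDr !mulnDl addnACA.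
Qed.

Lemma wt_inj j a b : wt a j = wt b j -> a = b.
Proof.
move=> e; apply/mnmP => i; move/mnmP/(_ i): e; rewrite !wtE.
by move/addIn/eqP; rewrite eqn_pmul2l // => /eqP.
Qed.

Lemma mdeg_wt a j : (mdeg a <= mdeg (wt a j))%N.
Proof. by rewrite mdegD mdegMn (leq_trans (leq_pmulr _ m_gt0)) ?leq_addr. Qed.

(* The codomain is K[W][y]: W is the variable of {poly K}, y those of mpoly. *)
Definition subst_coef : {mpoly K[n]} -> {mpoly {poly K}[n]} :=
  mmap (@mpolyC n {poly K} \o polyC) (fun i => 'X_[U_(i) *+ m]).

HB.instance Definition _ := GRing.RMorphism.on subst_coef.

Fact subst_comm : commr_rmorph subst_coef ('X%:MP * 'X_[g]).
Proof. by move=> x; apply: mulrC. Qed.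

Definition subst : {poly {mpoly K[n]}} -> {mpoly {poly K}[n]} :=
  horner_morph subst_comm.

HB.instance Definition _ := GRing.RMorphism.on subst.

Lemma subst_coefE p : subst_coef p =
  \sum_(a <- msupp p) (p@_a)%:P *: 'X_[a *+ m].
Proof.
rewrite /subst_coef /mmap; apply: eq_bigr => a _ /=.
rewrite mul_mpolyC; congr (_ *: _); rewrite /mmap1.
rewrite mprodXnE; congr 'X_[_].
apply/mnmP => i; rewrite mnm_sumE mulmnE (bigD1 i) //= big1 => [|k ki].
  by rewrite !mulmnE mnm1E eqxx mul1n addn0 mulnC.
by rewrite !mulmnE mnm1E (negPf ki).
Qed.

Lemma substE F u j : (subst F)@_u`_j =
  \sum_(a <- msupp F`_j) if wt a j == u then F`_j@_a else 0.
Proof.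
have -> : subst F = \sum_(i < size F) \sum_(a <- msupp F`_i)
    ((F`_i@_a)%:P * 'X^i) *: 'X_[wt a i].
  rewrite -{1}(coefK F) poly_def rmorph_sum; apply: eq_bigr => i _.
  rewrite -mul_polyC rmorphM rmorphXn /= {1 2}/subst.
  rewrite horner_morphC horner_morphX.
  rewrite -[X in X * _]/(subst_coef _) subst_coefE mulr_suml.
  apply: eq_bigr => a _.
  rewrite exprMn mpolyXn -rmorphXn /= mpolyXD -!mul_mpolyC rmorphM /=.
  by rewrite -!mulrA; congr (_ * _); rewrite mulrCA.
rewrite raddf_sum coef_sum.
under eq_bigr => i _.
  rewrite raddf_sum coef_sum.
  under eq_bigr => a _.
    rewrite /= mcoeffZ mcoeffX mulr_natr coefMn coefCM coefXn.
    over.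
  over.
have [ltjF|leFj] := ltnP j (size F).
  rewrite (bigD1 (Ordinal ltjF)) //= [X in _ + X]big1 ?addr0 => [|i].
    by apply: eq_bigr => a _; rewrite eqxx mulr1; case: eqP.
  rewrite -val_eqE /= eq_sym => /negPf ne.
  by apply: big1 => a _; rewrite ne mulr0 mul0rn.
rewrite (nth_default _ leFj) msupp0 big_nil big1 // => i _; apply: big1 => a _.
by rewrite gtn_eqF ?mulr0 ?mul0rn // (leq_trans (ltn_ord i)).
Qed.

(** Once j is fixed, [wt a j] determines [a], so no two monomials x^a Z^j collide and each keeps its
    coefficient. *)
Lemma subst_wt F a j : (subst F)@_(wt a j)`_j = F`_j@_a.
Proof.
rewrite substE; have [ain|/memN_msupp_eq0 a0] := boolP (a \in msupp F`_j).
  rewrite (bigD1_seq a) //= eqxx big1 ?addr0 // => b /negPf nb.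
  by case: eqP => // /wt_inj e; rewrite e eqxx in nb.
by rewrite a0 big1 // => b _; case: eqP => // /wt_inj ->.
Qed.

Lemma subst_neq0 F u j : (subst F)@_u`_j != 0 ->
  exists2 a, u = wt a j & F`_j@_a != 0.
Proof.
move=> n0; suff [a e]: exists a, u = wt a j.
  by exists a => //; rewrite -subst_wt -e.
have : has (fun a => wt a j == u) (msupp F`_j).
  apply: contraR n0 => /hasPn no; apply/eqP; rewrite substE big_seq big1 //.
  by move=> a /no /negPf ->.
by move=> /hasP[a _ /eqP <-]; exists a.
Qed.

Lemma subst_inj : injective subst.
Proof.
move=> F G e; apply/polyP => j; apply/mpolyP => a.
by rewrite -!subst_wt e.
Qed.

Lemma substC (c : K) : subst (c%:MP)%:P = c%:P%:MP.
Proof. by rewrite /subst horner_morphC [LHS]mmapC. Qed.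

End WeightedSubstitution.

(** * Homogeneous elements of K[W] for the (Z/m)^n-grading *)

Section Grading.
Variables (K : fieldType) (n m : nat) (g : 'X_{1..n}).
Hypothesis m_gt0 : (0 < m)%N.

Local Notation wt := (wt m g).

(* W^j has degree - k in (Z/m)^n, where W has degree - g. *)
Definition in_class (k : 'X_{1..n}) (j : nat) : bool :=
  [forall i, k i == j * g i %[mod m]].

Lemma in_classD k l i j : in_class l j ->
  in_class (k + l)%MM (i + j) = in_class k i.
Proof.
move=> /forallP lj; apply: eq_forallb => x; rewrite mnmDE mulnDl.
by rewrite -modnDmr (eqP (lj x)) modnDmr eqn_modDr.
Qed.

(** Subtraction of degrees with natural exponents: modulo [m], adding [l *+ m.-1] subtracts [l]. *)
Lemma in_class_shift k l : exists k', in_class (k' + l)%MM =1 in_class k.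
Proof.
exists (k + l *+ m.-1)%MM => j; apply: eq_forallb => i.
by rewrite !mnmDE mulmnE -addnA -mulnSr prednK // addnC modnMDl.
Qed.

Lemma in_class_wt a j : in_class (wt a j) j.
Proof. by apply/forallP => i; rewrite wtE mulnC modnMDl. Qed.

(** The congruence makes k - jg divisible by [m], and the order condition makes the quotient an
    exponent. Together they single out the monomials in the image of the substitution. *)
Lemma wt_of_class k j : in_class k j -> (g *+ j <= k)%MM ->
  exists a, k = wt a j.
Proof.
move=> /forallP kj /mnm_lepP le.
exists [multinom ((k i - j * g i) %/ m)%N | i < n]; apply/mnmP => i.
have lei : (j * g i <= k i)%N by have := le i; rewrite mulmnE mulnC.
rewrite wtE mnmE mulnC divnK ?subnK //.
by rewrite -eqn_mod_dvd // eq_sym.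
Qed.

(** Homogeneity of degree - k, so that y^k p has degree 0; the zero polynomial is homogeneous of
    every degree. *)
Definition graded k (p : {poly K}) := forall j, ~~ in_class k j -> p`_j = 0.

Lemma graded_class k p j : graded k p -> p`_j != 0 -> in_class k j.
Proof. by move=> hp; apply: contraR => /hp ->. Qed.

Lemma graded0 k : graded k 0. Proof. by move=> j; rewrite coef0. Qed.

Lemma gradedD k p q : graded k p -> graded k q -> graded k (p + q).
Proof. by move=> hp hq j nj; rewrite coefD hp ?hq ?addr0. Qed.

Lemma gradedN k p : graded k p -> graded k (- p).
Proof. by move=> hp j nj; rewrite coefN hp ?oppr0. Qed.

Lemma gradedZ k c p : graded k p -> graded k (c *: p).
Proof. by move=> hp j nj; rewrite coefZ hp ?mulr0. Qed.

Lemma gradedM k l p q : graded k p -> graded l q -> graded (k + l)%MM (p * q).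
Proof.
move=> hp hq j nj; rewrite coefM big1 // => i _.
have [lj|/hq ->] := boolP (in_class l (j - i)); last by rewrite mulr0.
by rewrite hp ?mul0r // -(in_classD k i lj) subnKC // -ltnS.
Qed.

Definition component k (p : {poly K}) : {poly K} :=
  \poly_(j < size p) (if in_class k j then p`_j else 0).

Lemma coef_component k p j :
  (component k p)`_j = if in_class k j then p`_j else 0.
Proof.
by rewrite coef_poly; case: ltnP => // le; case: ifP; rewrite ?nth_default.
Qed.

Lemma eq_component k l p :
  in_class k =1 in_class l -> component k p = component l p.
Proof. by move=> e; apply/polyP => j; rewrite !coef_component e. Qed.

Lemma size_component k p : (size (component k p) <= size p)%N.
Proof. exact: size_poly. Qed.

Lemma component_graded k p : graded k (component k p).
Proof. by move=> j /negPf nj; rewrite coef_component nj. Qed.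

Lemma component_id k p : graded k p -> component k p = p.
Proof.
by move=> hp; apply/polyP => j; rewrite coef_component; case: ifPn => // /hp ->.
Qed.

Lemma componentD k p q : component k (p + q) = component k p + component k q.
Proof.
apply/polyP => j; rewrite coefD !coef_component coefD.
by case: ifP; rewrite ?addr0.
Qed.

(** Multiplication by a homogeneous [q] translates all degrees by the same amount. *)
Lemma componentM k l p q : graded l q ->
  component (k + l)%MM (p * q) = component k p * q.
Proof.
move=> hq; apply/polyP => j; rewrite coef_component !coefM.
have nz (i : 'I_j.+1) : q`_(j - i) != 0 ->
    in_class (k + l)%MM j = in_class k i.
  by move=> /(graded_class hq)/(in_classD k i); rewrite subnKC // -ltnS.
case: ifPn => c.
  apply: eq_bigr => i _; rewrite coef_component.
  have [->|/nz <-] := eqVneq q`_(j - i) 0; first by rewrite !mulr0.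
  by rewrite c.
rewrite big1 // => i _; rewrite coef_component.
have [->|/nz <-] := eqVneq q`_(j - i) 0; first by rewrite mulr0.
by rewrite (negPf c) mul0r.
Qed.

(** Up to a scalar the gcd is u a + v b. As [a] and [b] are homogeneous, taking a component only
    changes u and v, and the result is still a combination of [a] and [b]. *)
Lemma gcdp_dvd_component k l a b k' : graded k a -> graded l b ->
  gcdp a b %| component k' (gcdp a b).
Proof.
move=> ha hb; set h := gcdp a b.
have [[u v] /= uv] := Bezoutp a b.
have /eqpf_eq[c _ e] : h %= u * a + v * b by rewrite eqp_sym.
have [k1 e1] := in_class_shift k' k; have [l1 e2] := in_class_shift k' l.
rewrite {2}e scalerDr !scalerAl componentD.
rewrite -(eq_component _ e1) -(eq_component (k := (l1 + l)%MM) _ e2).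
by rewrite !componentM // dvdp_add // dvdp_mull ?dvdp_gcdl ?dvdp_gcdr.
Qed.

(** The component containing the leading term has the same size as the gcd and is divisible by it,
    so the two are associate. *)
Lemma gcdp_graded k l a b : graded k a -> graded l b -> a != 0 ->
  graded (g *+ (size (gcdp a b)).-1)%MM (gcdp a b).
Proof.
move=> ha hb a0; set h := gcdp a b; set e := (size h).-1.
have h0 : h != 0 by rewrite gcdp_eq0 negb_and a0.
have sze : e.+1 = size h by rewrite prednK // size_poly_gt0.
set h' := component (g *+ e)%MM h.
have he : h'`_e != 0.
  have -> : h'`_e = h`_e; last by rewrite -/(lead_coef h) lead_coef_eq0.
  rewrite coef_component ifT //; apply/forallP => i.
  by rewrite mulmnE mulnC.
have szh' : size h = size h'.
  apply/eqP; rewrite eqn_leq size_component -sze andbT.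
  by rewrite ltnNge; apply: contra he => /(nth_default 0) ->.
have : h %= h'.
  by rewrite -dvdp_size_eqp ?szh' ?(gcdp_dvd_component _ ha hb).
by move=> /eqpf_eq[c _ ->]; apply/gradedZ/component_graded.
Qed.

Lemma graded_cofactor k l p q : q != 0 ->
  graded (k + l)%MM (p * q) -> graded l q -> graded k p.
Proof.
move=> q0 hpq hq; suff -> : p = component k p by apply: component_graded.
by apply: (mulIf q0); rewrite -(componentM _ _ hq) component_id.
Qed.

(** Bezout gives a solution, with [u] reduced modulo [a]; the size of [c] then bounds [v]. Since
    [a], [b] and [c] are homogeneous, the components of matching degree solve the same equation. *)
Lemma graded_bezout k l r a b c :
    graded k a -> graded l b -> graded (r + (k + l))%MM c ->
    a != 0 -> b != 0 -> coprimep a b -> (size c < size a + size b - 1)%N ->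
  exists u v, [/\ graded (r + k)%MM u, graded (r + l)%MM v,
    (size u < size a)%N, (size v < size b)%N & u * b + a * v = c].
Proof.
move=> ha hb hc a0 b0 /Bezout_eq1_coprimepP[[s t] /= st] szc.
pose u := (c * t) %% a.
(* Bezout gives c = c s a + c t b, and [u] is c t modulo [a]. *)
have: a %| c - u * b.
  apply/dvdpP; exists (c * s + c * t %/ a * b).
  have := divp_eq (c * t) a; rewrite -/u; set q := c * t %/ a => e.
  rewrite -{1}(mulr1 c) -st mulrDr !mulrA e !mulrDl addrA addrK.
  by congr (_ + _); rewrite mulrAC.
move=> /dvdpP[v ev]; have szu : (size u < size a)%N by rewrite ltn_modp.
have e : u * b + a * v = c by rewrite (mulrC a) -ev addrC subrK.
have szv : (size v < size b)%N.
  have [->|v0] := eqVneq v 0; first by rewrite size_poly0 size_poly_gt0.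
  have : (size (c - u * b)%R < size a + size b - 1)%N.
    apply: leq_ltn_trans (size_polyD _ _) _; rewrite gtn_max szc size_polyN.
    apply: leq_ltn_trans (size_polyMleq _ _) _.
    move: szu b0; rewrite -size_poly_gt0.
    by move: (size u) (size a) (size b) => x y z; lia.
  rewrite ev size_mul //; move: v0 a0; rewrite -!size_poly_gt0.
  by move: (size v) (size a) (size b) => x y z; lia.
exists (component (r + k)%MM u), (component (r + l)%MM v).
split; try exact: component_graded.
- exact: leq_ltn_trans (size_component _ _) _.
- exact: leq_ltn_trans (size_component _ _) _.
rewrite -(componentM _ _ hb) mulrC [X in _ + X]mulrC.
rewrite mulrC -(componentM _ _ ha) -!addmA [(l + k)%MM]addmC -componentD.
by rewrite (mulrC v) e component_id.
Qed.

(** Each term of h(W) y^(gp) is the image of a monomial x^a Z^j, where a solves m a + j g = p g;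
    homogeneity of [h] makes this solvable. *)
Lemma homogenisation p h : graded (g *+ p)%MM h -> (size h <= p.+1)%N ->
  exists H : {poly {mpoly K[n]}}, subst m g H = h%:MP * 'X_[g *+ p].
Proof.
move=> hh szh.
(* The division is exact wherever W^j occurs in [h]; rounded values elsewhere meet a zero
   coefficient. *)
pose a j := [multinom ((p - j) * g i %/ m)%N | i < n].
have waj j : h`_j != 0 -> wt (a j) j = (g *+ p)%MM.
  move=> hj; have lejp : (j <= p)%N.
    rewrite -ltnS (leq_trans _ szh) // ltnNge.
    by apply: contra hj => /leq_sizeP ->.
  have [b eb] : exists b, (g *+ p)%MM = wt b j.
    apply: wt_of_class (graded_class hh hj) _.
    by apply/mnm_lepP => i; rewrite !mulmnE leq_mul2l lejp orbT.
  rewrite eb; congr (wt _ _); apply/mnmP => i; rewrite mnmE mulnBl.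
  move/mnmP/(_ i): eb; rewrite wtE mulmnE mulnC => ->.
  by rewrite addnK mulKn.
pose H : {poly {mpoly K[n]}} := \poly_(j < size h) (h`_j *: 'X_[a j]).
have HE j b : H`_j@_b = if a j == b then h`_j else 0.
  rewrite coef_poly; case: ltnP => [_|le].
    by rewrite mcoeffZ mcoeffX; case: eqP; rewrite ?mulr1 ?mulr0.
  by rewrite mcoeff0 nth_default ?if_same.
exists H; apply/mpolyP => u; apply/polyP => j.
rewrite mcoeffCM mcoeffX mulr_natr coefMn.
have [Su|/(subst_neq0 m_gt0)[b eu]] := eqVneq (subst m g H)@_u`_j 0; last first.
  rewrite HE; case: (a j =P b) => [eb hj|_]; last by rewrite eqxx.
  by rewrite eu -eb subst_wt // HE eqxx waj // eqxx.
rewrite Su; case: (eqVneq h`_j 0) => [->|hj]; first by rewrite mul0rn.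
case: eqP Su => // <-; rewrite -(waj _ hj) subst_wt // HE eqxx => e.
by rewrite e eqxx in hj.
Qed.

End Grading.

(** * Coefficients of products of power series *)

Section PowerSeries.
Variables (n : nat) (A : comNzRingType).
Implicit Types (f h : fps n A) (u : 'X_{1..n}).

Lemma fps_mulE f h u : (f * h) u =
  \sum_(k : 'X_{1..n < (mdeg u).+1, (mdeg u).+1} | u == (k.1 + k.2)%MM)
     f k.1 * h k.2.
Proof. by []. Qed.

Lemma eq_fps_mul f h f' h' u :
    (forall k, (mdeg k <= mdeg u)%N -> f k = f' k) ->
    (forall k, (mdeg k <= mdeg u)%N -> h k = h' k) ->
  (f * h) u = (f' * h') u.
Proof.
move=> ef eh; rewrite !fps_mulE; apply: eq_bigr => -[[k1 lt1] [k2 lt2]] _ /=.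
by rewrite ef ?eh.
Qed.

(** A contributing k1 has degree at least [M], hence at least that of [u], which forces k2 = 0. This
    linearises the Hensel step. *)
Lemma fps_mul_low M f h u : (forall k, (mdeg k < M)%N -> f k = 0) ->
  (mdeg u <= M)%N -> (f * h) u = f u * h 0%MM.
Proof.
move=> low leu; rewrite fps_mulE.
rewrite (bigD1 (BMultinom (ltnSn (mdeg u)), bm0)) /= ?addm0 //.
rewrite big1 ?addr0 // => -[[k1 lt1] [k2 lt2]] /= /andP[/eqP eu ne].
have [/low ->|leM] := ltnP (mdeg k1) M; first by rewrite mul0r.
suff k20 : k2 == 0%MM.
  by move: ne; rewrite xpair_eqE !bmeqP /= eu (eqP k20) addm0 !eqxx.
rewrite -mdeg_eq0 -leqn0 -(leq_add2l (mdeg k1)) addn0 -mdegD -eu.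
exact: leq_trans leu leM.
Qed.

Definition fps_mono (s : 'X_{1..n}) : fps n A := Fps (fun k => (k == s)%:R).

Lemma fps_monoM s f u :
  (fps_mono s * f) u = if (s <= u)%MM then f (u - s)%MM else 0.
Proof.
rewrite fps_mulE; case: ifPn => [le|nle]; last first.
  rewrite big1 // => -[[k1 lt1] [k2 lt2]] /= /eqP eu.
  case: eqP => [ek|_]; last by rewrite mul0r.
  by rewrite eu ek lem_addr in nle.
have lts : (mdeg s < (mdeg u).+1)%N by rewrite -(submK le) mdegD ltnS leq_addl.
have ltus : (mdeg (u - s)%MM < (mdeg u).+1)%N by rewrite ltnS mdegB.
rewrite (bigD1 (BMultinom lts, BMultinom ltus)) /=; last first.
  by rewrite addmC submK.
rewrite eqxx mul1r big1 ?addr0 // => -[[k1 lt1] [k2 lt2]] /= /andP[/eqP eu ne].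
case: eqP => [ek|_]; last by rewrite mul0r.
by move: ne; rewrite xpair_eqE !bmeqP /= eu ek addmC addmK !eqxx.
Qed.

Lemma fps_mono_mul s t : fps_mono s * fps_mono t = fps_mono (s + t).
Proof.
apply/fpsP => u; rewrite fps_monoM /=; case: ifPn => [le|nle].
  by rewrite -(eqm_add2r s) submK // addmC.
by case: eqP => // e; rewrite e lem_addr in nle.
Qed.

End PowerSeries.

Lemma size_sum_lt (A : nzSemiRingType) (I : finType) (P : pred I)
    (E : I -> {poly A}) N : (0 < N)%N ->
  (forall i, P i -> (size (E i) < N)%N) -> (size (\sum_(i | P i) E i)%R < N)%N.
Proof.
move=> N0 sE; elim/big_ind: _ => // [|p q sp sq]; first by rewrite size_poly0.
by apply: leq_ltn_trans (size_polyD _ _) _; rewrite gtn_max sp.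
Qed.

(** * Hensel lifting with homogeneous corrections *)

Section Hensel.
Variables (K : fieldType) (n m : nat) (g : 'X_{1..n}).
Variables (k l : 'X_{1..n}) (a b : {poly K}) (Q : fps n {poly K}).
Hypotheses (m_gt0 : (0 < m)%N) (ka : graded m g k a) (lb : graded m g l b).
Hypotheses (a_neq0 : a != 0) (b_neq0 : b != 0) (coprime_ab : coprimep a b).
Hypothesis Q0 : Q 0%MM = a * b.
Hypothesis size_Q : forall u, u != 0%MM -> (size (Q u) < size a + size b - 1)%N.
Hypothesis graded_Q : forall u, graded m g (u + (k + l))%MM (Q u).

Local Notation graded := (graded m g).

(* The last clause says that each y^u F_u is homogeneous of degree - r. *)
Definition lift_of c r (F : fps n {poly K}) : Prop :=
  [/\ F 0%MM = c, forall u, u != 0%MM -> (size (F u) < size c)%N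
    & forall u, graded (u + r)%MM (F u)].

Definition approx N F G : Prop := [/\ lift_of a k F, lift_of b l G
  & forall u, (mdeg u <= N)%N -> (F * G) u = Q u].

Lemma size_lift c r F u : lift_of c r F -> (size (F u) <= size c)%N.
Proof.
by case=> F0 sF _; have [->|/sF/ltnW //] := eqVneq u 0%MM; rewrite F0.
Qed.

(** In every term k1 or k2 is nonzero, and the factor with that index has dropped in size. *)
Lemma size_lift_mul F G u : lift_of a k F -> lift_of b l G -> u != 0%MM ->
  (size ((F * G)%R u) < size a + size b - 1)%N.
Proof.
move=> lF lG u0; have [sa sb] : (0 < size a)%N /\ (0 < size b)%N.
  by rewrite !size_poly_gt0.
rewrite fps_mulE; apply: size_sum_lt => [|[[k1 lt1] [k2 lt2]] /= /eqP eu].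
  by move: sa sb; move: (size a) (size b) => x y; lia.
apply: leq_ltn_trans (size_polyMleq _ _) _.
have := size_lift k1 lF; have := size_lift k2 lG.
case: lF lG => [_ sF _] [_ sG _].
have [k10|/sF] := eqVneq k1 0%MM; last first.
  by move: sa sb (size (F _)) (size (G _)); move: (size a) (size b); lia.
have /sG : k2 != 0%MM by apply: contra u0 => /eqP k20; rewrite eu k10 k20 addm0.
by move: sa sb (size (F _)) (size (G _)); move: (size a) (size b); lia.
Qed.

Lemma graded_lift_mul F G u : lift_of a k F -> lift_of b l G ->
  graded (u + (k + l))%MM ((F * G) u).
Proof.
case=> [_ _ gF] [_ _ gG]; rewrite fps_mulE.
elim/big_ind: _ => [|p q gp gq|[[k1 lt1] [k2 lt2]] /= /eqP eu].
- exact: graded0.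
- exact: gradedD.
rewrite eu.
have -> : (k1 + k2 + (k + l) = (k1 + k) + (k2 + l))%MM.
  by apply/mnmP => i; rewrite !mnmDE addnACA.
exact: gradedM.
Qed.

(** The error at each exponent of degree N+1 is homogeneous and of smaller size than ab, so
    [graded_bezout] writes it as s b + a t; adding s to [F] and t to [G] cancels it. *)
Lemma approx_step N F G : approx N F G -> exists FG, approx N.+1 FG.1 FG.2 /\
  forall u, (mdeg u <= N)%N -> FG.1 u = F u /\ FG.2 u = G u.
Proof.
move=> [lF lG eqQ].
(* The degree condition stands under the existential so that [choice] yields a function of all
   exponents. *)
have corr u : exists st : {poly K} * {poly K}, mdeg u = N.+1 ->
    [/\ graded (u + k)%MM st.1, graded (u + l)%MM st.2, (size st.1 < size a)%N,
     (size st.2 < size b)%N & st.1 * b + a * st.2 = Q u - (F * G) u].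
  have [du|] := eqVneq (mdeg u) N.+1; last by move=> /eqP ne; exists 0 => /ne.
  have u0 : u != 0%MM by rewrite -mdeg_eq0 du.
  have [||s [t st]] := graded_bezout (r := u) m_gt0 ka lb _
    a_neq0 b_neq0 coprime_ab (c := Q u - (F * G) u).
  - by apply: gradedD => //; apply/gradedN/graded_lift_mul.
  - apply: leq_ltn_trans (size_polyD _ _) _.
    by rewrite gtn_max size_Q // size_polyN size_lift_mul.
  by exists (s, t).
have [st stP] := choice corr.
pose U : fps n {poly K} :=
  Fps (fun u => if mdeg u == N.+1 then (st u).1 else 0).
pose V : fps n {poly K} :=
  Fps (fun u => if mdeg u == N.+1 then (st u).2 else 0).
have U0 u : (mdeg u < N.+1)%N -> U u = 0 by move=> lt; rewrite /= ltn_eqF.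
have V0 u : (mdeg u < N.+1)%N -> V u = 0 by move=> lt; rewrite /= ltn_eqF.
have lift_add c r H (W : fps n {poly K}) : lift_of c r H -> W 0%MM = 0 ->
    (forall u, (size (W u) < size c)%N) ->
    (forall u, graded (u + r)%MM (W u)) -> lift_of c r (H + W).
  move=> [H0 sH gH] W0 sW gW; split=> [|u u0|u] /=.
  - by rewrite H0 W0 addr0.
  - by apply: leq_ltn_trans (size_polyD _ _) _; rewrite gtn_max sH ?sW.
  - exact: gradedD.
exists (F + U, G + V); split=> [|u leu]; last by rewrite /= ltn_eqF ?addr0.
split.
- apply: lift_add => // [|u|u]; first by rewrite U0 ?mdeg0.
    by rewrite /=; case: eqP => [/stP[]|]; rewrite // size_poly0 size_poly_gt0.
  by rewrite /=; case: eqP => [/stP[]|_] //; apply: graded0.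
- apply: lift_add => // [|u|u]; first by rewrite V0 ?mdeg0.
    by rewrite /=; case: eqP => [/stP[]|]; rewrite // size_poly0 size_poly_gt0.
  by rewrite /=; case: eqP => [/stP[]|_] //; apply: graded0.
move=> u leu; have [[F0 _ _] [G0 _ _]] := (lF, lG).
have -> : (F + U, G + V).1 * (F + U, G + V).2 = F * G + U * G + V * F + U * V.
  rewrite /= mulrDl !mulrDr (mulrC F V) -!addrA.
  by congr (_ + _); rewrite addrCA.
have -> : (F * G + U * G + V * F + U * V) u =
  (F * G) u + (U * G) u + (V * F) u + (U * V) u by [].
(* [U] and [V] start in degree N+1, so up to that degree only U_u b and V_u a remain, and the
   quadratic term vanishes. *)
rewrite (fps_mul_low G U0 leu) (fps_mul_low V U0 leu) (fps_mul_low F V0 leu).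
rewrite F0 G0 (V0 0%MM) ?mdeg0 // mulr0 addr0.
move: leu; rewrite leq_eqVlt => /predU1P[du|ltu]; last first.
  by rewrite U0 // V0 // !mul0r !addr0 eqQ.
have [-> ->] : U u = (st u).1 /\ V u = (st u).2 by rewrite /= du eqxx.
rewrite -addrA (mulrC (st u).2); have [_ _ _ _ ->] := stP u du.
by rewrite addrC subrK.
Qed.

(** Iterating [approx_step] from the constant series [a] and [b] freezes the coefficients of degree
    at most N from stage N on, so the stages have a limit. *)
Lemma hensel_lifting :
  exists F G, [/\ lift_of a k F, lift_of b l G & F * G = Q].
Proof.
have lift0 c r : c != 0 -> graded r c ->
    lift_of c r (Fps (fun u => if u == 0%MM then c else 0)).
  move=> c0 gc; split=> [|u /negPf u0|u] /=; first by rewrite eqxx.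
    by rewrite u0 size_poly0 size_poly_gt0.
  by case: eqP => [->|_]; [rewrite add0m | exact: graded0].
(* Stated for arbitrary pairs, approximations or not, so that the recursion [FG] can be defined
   before its invariant is proved. *)
have stepP (x : nat * (fps n {poly K} * fps n {poly K})) :
    exists FG, approx x.1 x.2.1 x.2.2 -> approx x.1.+1 FG.1 FG.2 /\
      forall u, (mdeg u <= x.1)%N -> FG.1 u = x.2.1 u /\ FG.2 u = x.2.2 u.
  case: x => N [F G] /=; have [/approx_step[FG ?]|no] := pselect (approx N F G).
    by exists FG.
  by exists (F, G) => /no.
have [step {}stepP] := choice stepP.
pose FG0 : fps n {poly K} * fps n {poly K} :=
  (Fps (fun u => if u == 0%MM then a else 0),
   Fps (fun u => if u == 0%MM then b else 0)).
pose FG := fix FG N := if N is N'.+1 then step (N', FG N') else FG0.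
have FGP N : approx N (FG N).1 (FG N).2.
  elim: N => [|N IH]; last by have [] := stepP (N, FG N) IH.
  split; [exact: lift0 | exact: lift0 | move=> u].
  rewrite leqn0 => /[dup] /eqP du.
  rewrite mdeg_eq0 => /eqP u0; rewrite (@fps_mul_low _ _ 0) ?du //.
  by rewrite u0 /= eqxx Q0.
have stable N M u : (mdeg u <= N)%N -> (N <= M)%N ->
    (FG M).1 u = (FG N).1 u /\ (FG M).2 u = (FG N).2 u.
  move=> leu; elim: M => [|M IH]; first by rewrite leqn0 => /eqP ->.
  rewrite leq_eqVlt ltnS => /predU1P[->//|leNM].
  have [_ /(_ u (leq_trans leu leNM))] := stepP (M, FG M) (FGP M).
  by rewrite /= => -[-> ->]; apply: IH.
(* The limit is read off diagonally: stage |u| already has the final coefficient at [u]. *)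
pose F : fps n {poly K} := Fps (fun u => (FG (mdeg u)).1 u).
pose G : fps n {poly K} := Fps (fun u => (FG (mdeg u)).2 u).
exists F, G; split.
- split=> [|u u0|u] /=; first by rewrite mdeg0 /= eqxx.
    by have [[_ /(_ u u0)]] := FGP (mdeg u).
  by have [[_ _ /(_ u)]] := FGP (mdeg u).
- split=> [|u u0|u] /=; first by rewrite mdeg0 /= eqxx.
    by have [_ [_ /(_ u u0)]] := FGP (mdeg u).
  by have [_ [_ _ /(_ u)]] := FGP (mdeg u).
apply/fpsP => u; have [_ _ <- //] := FGP (mdeg u).
by apply: eq_fps_mul => v lev /=; have [] := stable (mdeg v) (mdeg u) v.
Qed.

End Hensel.

Lemma fps_sumE (n : nat) (A : comNzRingType) (I : Type) (r : seq I) (P : pred I)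
    (f : I -> fps n A) u :
  (\sum_(i <- r | P i) f i) u = \sum_(i <- r | P i) f i u.
Proof. exact: (big_morph (fun h : fps n A => h u)). Qed.

(** * The substitution on polynomials over power series, and its image *)

Section PowerSeriesSubstitution.
Variables (K : fieldType) (n m : nat) (g : 'X_{1..n}).
Hypothesis m_gt0 : (0 < m)%N.

Local Notation wt := (wt m g).
Local Notation subst := (subst m g).

Lemma eq_subst (F G : {poly {mpoly K[n]}}) u :
    (forall j a, u = wt a j -> F`_j@_a = G`_j@_a) ->
  (subst F)@_u = (subst G)@_u.
Proof.
move=> eFG; apply/polyP => j.
have [e0|/(subst_neq0 m_gt0)[a eu _]] := eqVneq (subst F)@_u`_j 0; last first.
  by rewrite eu !(subst_wt g m_gt0) eFG.
have [e0'|/(subst_neq0 m_gt0)[a eu _]] := eqVneq (subst G)@_u`_j 0.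
  by rewrite e0 e0'.
by rewrite eu !(subst_wt g m_gt0) eFG.
Qed.

Definition trunc_poly b (F : {poly (fps n K)}) : {poly {mpoly K[n]}} :=
  \poly_(j < size F) fps_trunc b F`_j.

Lemma coef_trunc_poly b F j a : (mdeg a < b)%N ->
  (trunc_poly b F)`_j@_a = F`_j a.
Proof.
move=> lt; rewrite coef_poly; case: ltnP => [_|le]; first exact: coef_fps_trunc.
by rewrite mcoeff0 nth_default.
Qed.

(* Only the terms of F of degree at most |u| contribute to the coefficient
   of y^u. *)
Definition psubst (F : {poly (fps n K)}) : fps n {poly K} :=
  Fps (fun u => (subst (trunc_poly (mdeg u).+1 F))@_u).

Lemma psubst_trunc b F u : (mdeg u < b)%N ->
  (subst (trunc_poly b F))@_u = psubst F u.
Proof.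
move=> ltub; apply: eq_subst => j a eu.
have lea : (mdeg a <= mdeg u)%N by rewrite eu mdeg_wt.
by rewrite !coef_trunc_poly // (leq_ltn_trans lea).
Qed.

Lemma psubst_wt F a j : (psubst F (wt a j))`_j = F`_j a.
Proof. by rewrite subst_wt // coef_trunc_poly // ltnS mdeg_wt. Qed.

Lemma psubst_neq0 F u j : (psubst F u)`_j != 0 ->
  exists2 a, u = wt a j & F`_j a != 0.
Proof.
move=> Fu; have [a eu _] := subst_neq0 m_gt0 Fu.
by exists a => //; rewrite -psubst_wt -eu.
Qed.

Lemma psubst_inj : injective psubst.
Proof.
by move=> F G e; apply/polyP => j; apply/fpsP => a; rewrite -!psubst_wt e.
Qed.

(** At [u] everything may be truncated beyond degree |u|, where [subst] is a ring morphism and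
    truncation respects products up to that degree. *)
Lemma psubstM F G : psubst (F * G) = psubst F * psubst G.
Proof.
apply/fpsP => u; have ltu := ltnSn (mdeg u).
have tr H k (lt : (mdeg k < (mdeg u).+1)%N) := psubst_trunc H lt.
have <- := fps_mul_coef ltu (tr F) (tr G).
rewrite -rmorphM; apply: eq_subst => j a eu.
have lta : (mdeg a < (mdeg u).+1)%N by rewrite eu ltnS mdeg_wt.
rewrite coef_trunc_poly // !coefM fps_sumE raddf_sum; apply: eq_bigr => i _ /=.
by symmetry; apply: (fps_mul_coef lta) => k lt; apply: coef_trunc_poly.
Qed.

(** Homogeneity and [wt_of_class] put every monomial of y^(gp) F in the image of the substitution,
    so its coefficients can be read back as those of a polynomial in Z. *)
Lemma psubst_descent p (a : {poly K}) (F : fps n {poly K}) : a \is monic ->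
    size a = p.+1 -> lift_of m g a (g *+ p)%MM F ->
  exists P : {poly (fps n K)},
    [/\ psubst P = fps_mono _ (g *+ p) * F, P \is monic & size P = p.+1].
Proof.
move=> mon_a sz lF; have leF u := size_lift u lF; have [F0 sF gF] := lF.
pose P : {poly (fps n K)} := \poly_(j < p.+1)
  Fps (fun b =>
    if (g *+ p <= wt b j)%MM then (F (wt b j - g *+ p)%MM)`_j else 0).
(* The coefficient of x^b here is that of W^p in [F] at exponent [b *+ m]. The strict size bound in
   [lift_of] kills it unless b = 0, where [a] monic gives 1. *)
have Pp : P`_p = 1.
  apply/fpsP => b; rewrite coef_poly ltnSn /= lem_addl addmK.
  have [->|b0] := eqVneq b 0%MM.
    have -> : (0 *+ m = 0 :> 'X_{1..n})%MM.
      by apply/mnmP => i; rewrite mulmnE mnm0E mul0n.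
    by rewrite F0 -(monicP mon_a) lead_coefE sz.
  rewrite nth_default // -ltnS -sz sF // -mdeg_eq0 mdegMn muln_eq0 mdeg_eq0.
  by rewrite (negPf b0) -lt0n.
have szP : size P = p.+1.
  rewrite size_poly_eq //; move: Pp; rewrite coef_poly ltnSn => ->.
  exact: oner_neq0.
exists P; split=> //; last by apply/monicP; rewrite lead_coefE szP.
apply/fpsP => u; rewrite fps_monoM; apply/polyP => j.
have [[b ->]|nex] := pselect (exists b, u = wt b j).
  rewrite psubst_wt coef_poly; case: ltnP => [_|le] /=.
    by case: ifP; rewrite ?coef0.
  by case: ifP => _; rewrite ?coef0 // nth_default // (leq_trans (leF _)) ?sz.
have [->|/psubst_neq0[b eu _]] := eqVneq (psubst P u)`_j 0; last first.
  by case: nex; exists b.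
case: ifP => [le|_]; last by rewrite coef0.
have [->|Fj] // := eqVneq (F (u - g *+ p)%MM)`_j 0; case: nex.
have lejp : (j <= p)%N.
  rewrite -ltnS -sz ltnNge; apply: contra Fj => lej.
  by rewrite nth_default // (leq_trans (leF _)).
apply: wt_of_class => //.
  by have := graded_class (gF _) Fj; rewrite submK.
apply: lepm_trans le; apply/mnm_lepP => i.
by rewrite !mulmnE leq_mul2l lejp orbT.
Qed.

End PowerSeriesSubstitution.

(** * Common divisors pulled back to K[x, Z] *)

Section Descent.
Variables (K : fieldType) (n m : nat) (g : 'X_{1..n}).
Hypothesis m_gt0 : (0 < m)%N.

Local Notation wt := (wt m g).
Local Notation subst := (subst m g).
Local Notation graded := (graded m g).

Lemma mpoly_single_monomial (R : nzRingType) (p : {mpoly R[n]}) N :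
  (forall u, p@_u != 0 -> u = N) -> p = (p@_N)%:MP * 'X_[N].
Proof.
move=> pN; apply/mpolyP => u; rewrite mcoeffCM mcoeffX.
case: eqP => [<-|ne]; first by rewrite mulr1.
by rewrite mulr0; have [//|/pN e] := eqVneq p@_u 0; rewrite e in ne.
Qed.

(** The cofactor of [h] in [a] is again homogeneous, so it homogenises with y-exponent g(p - e);
    injectivity of [subst] transports the product back. *)
Lemma divides_dvdp p (A : {poly {mpoly K[n]}}) (a : {poly K}) e
    (H : {poly {mpoly K[n]}}) (h : {poly K}) :
    subst A = a%:MP * 'X_[g *+ p] -> size a = p.+1 -> graded (g *+ p)%MM a ->
    subst H = h%:MP * 'X_[g *+ e] -> size h = e.+1 -> graded (g *+ e)%MM h ->
  h %| a -> divides H A.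
Proof.
move=> sA sza ga sH szh gh /dvdpP[q eq].
have h0 : h != 0 by rewrite -size_poly_gt0 szh.
have q0 : q != 0.
  by apply/eqP => q0; move: sza; rewrite eq q0 mul0r size_poly0.
have szq : (size q + e = p.+1)%N by move: sza; rewrite eq size_mul // szh addnS.
have lep : (e <= p)%N by move: szq; rewrite -size_poly_gt0 in q0; lia.
have gq : graded (g *+ (p - e))%MM q.
  apply: (graded_cofactor (l := (g *+ e)%MM) h0) => //; rewrite -eq.
  by have -> // : (g *+ (p - e) + g *+ e = g *+ p)%MM;
    apply/mnmP => i; rewrite mnmDE !mulmnE -mulnDr subnK.
have [|G sG] := homogenisation m_gt0 gq; first by rewrite -subSn // -szq addnK.
exists G; apply: (subst_inj m_gt0 (g := g)).
rewrite rmorphM /= sA sG sH eq rmorphM /=.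
have -> : (g *+ p = g *+ (p - e) + g *+ e)%MM.
  by apply/mnmP => i; rewrite mnmDE !mulmnE -mulnDr subnK.
by rewrite mpolyXD mulrACA.
Qed.

(** The gcd of [a] and [b] is homogeneous, hence comes from a common divisor of [A] and [B], which
    is constant. *)
Lemma coprime_subst p q (A B : {poly {mpoly K[n]}}) (a b : {poly K}) :
    subst A = a%:MP * 'X_[g *+ p] -> size a = p.+1 -> graded (g *+ p)%MM a ->
    subst B = b%:MP * 'X_[g *+ q] -> size b = q.+1 -> graded (g *+ q)%MM b ->
  coprime_poly A B -> coprimep a b.
Proof.
move=> sA sza ga sB szb gb AB; rewrite /coprimep; set h := gcdp a b.
have a0 : a != 0 by rewrite -size_poly_gt0 sza.
have h0 : h != 0 by rewrite gcdp_eq0 negb_and a0.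
pose e := (size h).-1.
have sze : size h = e.+1 by rewrite prednK // size_poly_gt0.
have gh : graded (g *+ e)%MM h := gcdp_graded m_gt0 ga gb a0.
have [|H sH] := homogenisation m_gt0 gh; first by rewrite sze.
have [c eH] : is_constant H.
  apply: AB.
    exact: (divides_dvdp sA sza ga sH sze gh (dvdp_gcdl _ _)).
  exact: (divides_dvdp sB szb gb sH sze gh (dvdp_gcdr _ _)).
(* At y^(ge) W^e stands the leading coefficient of [h], whereas a constant has no W^e term for e >
   0. *)
have := congr1 (fun x : {mpoly {poly K}[n]} => (x@_(g *+ e)%MM)`_e) sH.
rewrite /= eH substC mcoeffCM mcoeffX eqxx mulr1 mcoeffC mulr_natr coefMn coefC.
have: h`_e != 0 by move: h0; rewrite -lead_coef_eq0 lead_coefE sze.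
by rewrite sze; case: (e) => // e' /eqP he /esym; rewrite mul0rn.
Qed.

End Descent.

(** * Clearing denominators, and the inequalities given by the polyhedron *)

Lemma common_denominator (n : nat) (gamma : 'I_n -> rat) :
    (forall i, 0 <= gamma i) ->
  exists m (g : 'X_{1..n}), (0 < m)%N /\
    forall i, (g i)%:R = m%:R * gamma i :> rat.
Proof.
move=> g_ge0; pose m := (\prod_i `|denq (gamma i)|)%N.
have m_gt0 : (0 < m)%N by apply: prodn_gt0 => i; rewrite absz_gt0 denq_neq0.
have nat_mg i : exists k : nat, k%:R = m%:R * gamma i :> rat.
  exists ((\prod_(j | j != i) `|denq (gamma j)|) * `|numq (gamma i)|)%N.
  have dg : (`|denq (gamma i)|%N)%:R * gamma i = (`|numq (gamma i)|%N)%:R.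
    rewrite !natr_absz !ger0_norm ?numq_ge0 ?denq_ge0 //.
    by rewrite [RHS]numqE mulrC.
  by rewrite /m [in RHS](bigD1 i) //= !natrM [RHS]mulrAC dg mulrC.
have [k kP] := choice nat_mg.
by exists m, [multinom k i | i < n]; split=> // i; rewrite mnmE.
Qed.

(** The scaled exponent of the term lies in the polyhedron, hence in the translated orthant;
    coordinate [i] gives the inequality over [R], which descends to [rat]. *)
Lemma associated_polyhedron_bound (R : realType) (K : fieldType) (n d : nat)
    (P : {poly (fps n K)}) (gamma : 'I_n -> rat) j (a : 'X_{1..n}) i :
    orthant_associated_polyhedron R d P gamma -> (0 < d)%N ->
    (j < d)%N -> P`_j a != 0 ->
  gamma i * (d - j)%:R <= (a i)%:R.
Proof.
move=> [_ eqD] d0 ltjd Pja.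
pose v : 'rV[R]_n := \row_k (d%:R * (a k)%:R / (d - j)%:R).
have : (associated_polyhedron d P : set _) v.
  (* The hull is an intersection of convex sets [C]; each contains [v], written as [v] plus the zero
     vector of the orthant. *)
  move=> C [_]; apply; exists v; first by exists j, a.
  by exists 0; [move=> k; rewrite mxE | rewrite addr0].
rewrite eqD => -[_ -> [w w0 /rowP/(_ i)]]; rewrite !mxE => e.
have dj0 : 0 < (d - j)%:R :> R by rewrite ltr0n subn_gt0.
have : d%:R * ratr (gamma i) <= d%:R * (a i)%:R / (d - j)%:R :> R.
  by rewrite -e lerDl w0.
rewrite ler_pdivlMr // -mulrA ler_pM2l ?ltr0n //.
by rewrite -[(d - j)%:R]ratr_nat -[(a i)%:R]ratr_nat -rmorphM /= ler_rat.
Qed.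

(** * From a factorisation of the initial form to one of P *)

Section Factorisation.
Variables (K : fieldType) (n d m : nat) (g : 'X_{1..n}).
Variables (P : {poly (fps n K)}) (gamma : 'I_n -> rat).
Hypotheses (m_gt0 : (0 < m)%N).
Hypothesis gE : forall i, (g i)%:R = m%:R * gamma i :> rat.

Local Notation wt := (wt m g).
Local Notation subst := (subst m g).
Local Notation graded := (graded m g).

(** Multiplying a_i / (d - j) = gamma_i by m (d - j) gives m a_i + j g_i = d g_i. *)
Lemma on_slope_wt j a : (j < d)%N ->
  on_slope d gamma j a = (wt a j == g *+ d)%MM.
Proof.
move=> ltjd; have dj0 : ((d - j)%:R : rat) != 0.
  by rewrite pnatr_eq0 -lt0n subn_gt0.
have m0 : (m%:R : rat) != 0 by rewrite pnatr_eq0 -lt0n.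
have eq_i i : ((a i)%:R / (d - j)%:R == gamma i) = (wt a j i == (g *+ d)%MM i).
  rewrite wtE mulmnE mulnC -(subnK (ltnW ltjd)) mulnDr (mulnC (g i) j).
  rewrite eqn_add2r.
  rewrite subnK ?(ltnW ltjd) // -(inj_eq (mulIf dj0)) divfK //.
  rewrite -(inj_eq (mulfI m0)) mulrA -gE -!natrM eqr_nat.
  by rewrite (mulnC (a i)).
apply/forallP/eqP => [sl|e i]; last by rewrite eq_i e.
by apply/mnmP => i; apply/eqP; rewrite -eq_i.
Qed.

Lemma subst_initial_form u :
  (subst (initial_form d gamma P))@_u != 0 -> u = (g *+ d)%MM.
Proof.
move=> nz; have [j nzj] : exists j, (subst (initial_form d gamma P))@_u`_j != 0.
  exists (size (subst (initial_form d gamma P))@_u).-1.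
  by rewrite -lead_coefE lead_coef_eq0.
have [a -> ] := subst_neq0 m_gt0 nzj; rewrite coef_initial_form.
case: ltnP => [ltjd|_].
  by rewrite on_slope_wt //; case: (wt a j =P _); rewrite ?eqxx.
have [->|] := eqVneq j d; last by rewrite eqxx.
have [->|] := eqVneq a 0%MM; last by rewrite eqxx.
by move=> _; apply/mnmP => i; rewrite wtE mnm0E muln0 mulmnE mulnC.
Qed.

Lemma wt0 j : wt 0%MM j = (g *+ j)%MM.
Proof. by apply/mnmP => i; rewrite wtE mnm0E muln0 mulmnE mulnC. Qed.

(** Both factors become monomials in y by [mpoly_mul_monomial]. Their leading W-terms then pin the
    y-exponents down to gp and gq. *)
Lemma subst_factors (A B : {poly {mpoly K[n]}}) :
    initial_form d gamma P = A * B ->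
  exists p q (a b : {poly K}), [/\ (p + q = d)%N,
    [/\ subst A = a%:MP * 'X_[g *+ p], size a = p.+1 & graded (g *+ p)%MM a],
    [/\ subst B = b%:MP * 'X_[g *+ q], size b = q.+1 & graded (g *+ q)%MM b],
    a * b \is monic &
    a * b = (subst (initial_form d gamma P))@_(g *+ d)].
Proof.
set I := initial_form d gamma P => eI.
have Sd : (subst I)@_(g *+ d)`_d = 1.
  by rewrite -wt0 subst_wt // coef_initial_form ltnn !eqxx.
have SI0 : subst I != 0.
  by apply/eqP => S0; have := oner_neq0 K; rewrite -Sd S0 mcoeff0 coef0 eqxx.
have eS : subst I = subst A * subst B by rewrite eI rmorphM.
have [N1 A1] : exists N1, forall u, (subst A)@_u != 0 -> u = N1.
  apply: (@mpoly_mul_monomial _ _ _ (subst B) (g *+ d)%MM).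
    by rewrite -eS.
  by rewrite -eS; apply: subst_initial_form.
have [N2 B1] : exists N2, forall u, (subst B)@_u != 0 -> u = N2.
  apply: (@mpoly_mul_monomial _ _ _ (subst A) (g *+ d)%MM).
    by rewrite mulrC -eS.
  by rewrite mulrC -eS; apply: subst_initial_form.
have [a aE sA] : exists2 a, a = (subst A)@_N1 & subst A = a%:MP * 'X_[N1].
  by exists (subst A)@_N1 => //; apply: mpoly_single_monomial.
have [b bE sB] : exists2 b, b = (subst B)@_N2 & subst B = b%:MP * 'X_[N2].
  by exists (subst B)@_N2 => //; apply: mpoly_single_monomial.
have sI : subst I = (a * b)%:MP * 'X_[N1 + N2].
  by rewrite eS sA sB mulrACA -mpolyXD rmorphM.
have eN : (N1 + N2 = g *+ d)%MM.
  apply/eqP; move: Sd; rewrite sI mcoeffCM mcoeffX; case: eqP => // _ /esym/eqP.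
  by rewrite mulr0 coef0 oner_eq0.
have eab : a * b = (subst I)@_(g *+ d).
  by rewrite sI eN mcoeffCM mcoeffX eqxx mulr1.
have ab0 : a * b != 0.
  by apply/eqP => ab0; have := oner_neq0 K; rewrite -Sd -eab ab0 coef0 eqxx.
have [a0 b0] : a != 0 /\ b != 0 by apply/andP; rewrite -negb_or -mulf_eq0.
have szab : size (a * b) = d.+1.
  apply/eqP; rewrite eqn_leq; apply/andP; split.
    apply/leq_sizeP => j ltdj; rewrite eab; apply/eqP; apply/negPn/negP.
    move=> /(subst_neq0 m_gt0)[c _]; rewrite coef_initial_form.
    by rewrite ltnNge ltnW //= gtn_eqF // eqxx.
  rewrite ltnNge; apply/negP => /leq_sizeP/(_ d (leqnn d))/eqP.
  by rewrite eab Sd oner_eq0.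
have mon : a * b \is monic by apply/monicP; rewrite lead_coefE szab /= eab Sd.
pose p := (size a).-1; pose q := (size b).-1.
have sza : size a = p.+1 by rewrite prednK ?size_poly_gt0.
have szb : size b = q.+1 by rewrite prednK ?size_poly_gt0.
have pqd : (p + q = d)%N.
  by move: szab; rewrite size_mul // sza szb addnS => -[].
have ap : (subst A)@_N1`_p != 0 by rewrite -aE -lead_coefE lead_coef_eq0.
have bq : (subst B)@_N2`_q != 0 by rewrite -bE -lead_coefE lead_coef_eq0.
have [c eN1 _] := subst_neq0 m_gt0 ap; have [c' eN2 _] := subst_neq0 m_gt0 bq.
(* The two y-exponents are [wt c p] and [wt c' q] and add up to gd, which leaves nothing for [c] and
   [c']. *)
have: (c + c' == 0)%MM.
  apply/eqP; apply: (wt_inj (g := g) m_gt0 (j := d)).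
  by rewrite wt0 -eN -pqd eN1 eN2 wtD.
rewrite mnmD_eq0 => /andP[/eqP c0 /eqP c'0].
rewrite c0 wt0 in eN1; rewrite c'0 wt0 in eN2.
have ga : graded N1 a.
  move=> j; apply: contraNeq; rewrite aE.
  by move=> /(subst_neq0 m_gt0)[x -> _]; apply: in_class_wt.
have gb : graded N2 b.
  move=> j; apply: contraNeq; rewrite bE.
  by move=> /(subst_neq0 m_gt0)[x -> _]; apply: in_class_wt.
by exists p, q, a, b; split; rewrite -?eN1 -?eN2.
Qed.

Hypothesis size_P : size P = d.+1.
Hypothesis monic_P : P \is monic.
Hypothesis above_slope : forall j a i, (j < d)%N -> P`_j a != 0 ->
  gamma i * (d - j)%:R <= (a i)%:R.

Lemma lead_term a : P`_d a = (a == 0%MM)%:R.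
Proof. by have := monicP monic_P; rewrite lead_coefE size_P => ->. Qed.

(** Multiplied by [m], [above_slope] reads d g_i <= m a_i + j g_i; thus y^(gd) divides the image of
    [P]. *)
Lemma support_wt j a : P`_j a != 0 -> (g *+ d <= wt a j)%MM.
Proof.
have [ltjd Pja|ltdj|->] := ltngtP j d.
- apply/mnm_lepP => i; rewrite wtE mulmnE mulnC -(subnK (ltnW ltjd)) mulnDl.
  rewrite leq_add2r -(ler_nat rat) !natrM gE mulrCA ler_wpM2l ?ler0n //.
  by rewrite mulrC above_slope // subnK // ltnW.
- by rewrite nth_default ?eqxx // size_P.
rewrite lead_term; case: (a =P 0%MM) => [->|_]; last by rewrite eqxx.
by rewrite wt0 lepm_refl.
Qed.

(** The y-exponent gd is attained exactly by Z^d and the terms on the slope. *)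
Lemma psubst_initial :
  psubst m g P (g *+ d)%MM = (subst (initial_form d gamma P))@_(g *+ d).
Proof.
have e a j : (g *+ d)%MM = wt a j -> P`_j a = (initial_form d gamma P)`_j@_a.
  move=> e; rewrite coef_initial_form; have [ltjd|ltdj|jd] := ltngtP j d.
  - by rewrite on_slope_wt // -e eqxx.
  - by rewrite nth_default ?size_P //.
  by rewrite jd lead_term.
apply/polyP => j.
have [[a ea]|nex] := pselect (exists a, (g *+ d)%MM = wt a j).
  by rewrite ea (psubst_wt g m_gt0) (subst_wt g m_gt0) (e _ _ ea).
have [->|/(psubst_neq0 m_gt0)[a ea _]] :=
  eqVneq (psubst m g P (g *+ d)%MM)`_j 0; last by case: nex; exists a.
have [->|/(subst_neq0 m_gt0)[a ea _]] :=
  eqVneq (subst (initial_form d gamma P))@_(g *+ d)`_j 0; first by [].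
by case: nex; exists a.
Qed.

(** The image of [P] is y^(gd) Q. Hensel factors Q, and the monomials y^(gp) and y^(gq) are
    distributed over the two factors before each descends. *)
Lemma coprime_factors_lift p q (a b : {poly K}) : (p + q = d)%N ->
    a \is monic -> b \is monic -> size a = p.+1 -> size b = q.+1 ->
    graded (g *+ p)%MM a -> graded (g *+ q)%MM b -> coprimep a b ->
    a * b = (subst (initial_form d gamma P))@_(g *+ d) ->
  exists F G, [/\ P = F * G, F \is monic, G \is monic, size F = p.+1
    & size G = q.+1].
Proof.
move=> pqd mon_a mon_b sza szb ga gb cop eab.
have gpq : (g *+ p + g *+ q = g *+ d)%MM.
  by apply/mnmP => i; rewrite mnmDE !mulmnE -mulnDr pqd.
pose Q : fps n {poly K} := Fps (fun u => psubst m g P (u + g *+ d)%MM).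
have PQ : psubst m g P = fps_mono _ (g *+ d) * Q.
  apply/fpsP => u; rewrite fps_monoM; case: ifPn => [le|nle].
    by rewrite -[RHS]/(psubst m g P (u - g *+ d + g *+ d)%MM) submK.
  apply/polyP => j; rewrite coef0; apply: contraNeq nle.
  by move=> /(psubst_neq0 m_gt0)[c -> /support_wt].
have [||||||Fh [Gh [lF lG FGQ]]] :=
    @hensel_lifting K n m g (g *+ p)%MM (g *+ q)%MM a b Q m_gt0 ga gb.
- exact: monic_neq0.
- exact: monic_neq0.
- exact: cop.
- by rewrite -[LHS]/(psubst m g P (0 + g *+ d)%MM) add0m psubst_initial.
(* The bound is W-degree less than d: W^d arises only from Z^d, which sits at u = 0. *)
- move=> u u0; rewrite sza szb addSn addnS subn1 ltnS pqd.
  apply/leq_sizeP => j ledj.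
  apply: contraNeq u0 => /(psubst_neq0 m_gt0)[c eu].
  move: ledj; rewrite leq_eqVlt => /predU1P[ej|ltdj].
    rewrite -ej lead_term in eu *.
    case: (c =P 0%MM) => [c0 _|]; last by rewrite eqxx.
    by rewrite -(eqm_add2r (g *+ d)%MM) add0m eu c0 wt0.
  by rewrite nth_default ?eqxx // size_P.
- move=> u j; apply: contraNeq => /(psubst_neq0 m_gt0)[c eu _].
  by rewrite gpq eu in_class_wt.
have [F [sF mF szF]] := psubst_descent m_gt0 mon_a sza lF.
have [G [sG mG szG]] := psubst_descent m_gt0 mon_b szb lG.
exists F, G; split=> //; apply: (psubst_inj m_gt0 (g := g)).
by rewrite (psubstM g m_gt0) sF sG mulrACA fps_mono_mul gpq FGQ PQ.
Qed.

End Factorisation.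

(** * Contradiction with irreducibility *)

(** Degrees add in a product with a monic factor even if [A] has zero divisors, so no multiple of
    [p] equals 1. *)
Lemma monic_not_invertible (A : comNzRingType) (p : {poly A}) :
  p \is monic -> (1 < size p)%N -> ~ invertible p.
Proof.
move=> mp szp [h ph]; have h0 : h != 0.
  by apply: contra_eq_neq ph => ->; rewrite mulr0 eq_sym oner_neq0.
have := size_monicM mp h0; rewrite ph size_poly1.
by move: szp h0; rewrite -size_poly_gt0; lia.
Qed.

Theorem theorem2p3 (R : realType) (K : fieldType) (n d : nat)
    (P : {poly (fps n K)}) (gamma : 'I_n -> rat) :
  (0 < n)%N -> (0 < d)%N ->
  P \is monic -> size P = d.+1 -> P <> 'X^d ->
  irreducible P ->
  orthant_associated_polyhedron R d P gamma ->
  ~ exists A B : {poly {mpoly K[n]}},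
      [/\ initial_form d gamma P = A * B,
          ~ is_constant A, ~ is_constant B & coprime_poly A B].
Proof.
move=> _ d_gt0 monP szP _ [_ _ irrP] orthP [A [B [eAB ncA ncB copAB]]].
have [m [g [m_gt0 gE]]] := common_denominator (proj1 orthP).
have [p [q [a [b [pqd [sA sza ga] [sB szb gb] monab eab]]]]] :=
  subst_factors m_gt0 gE eAB.
(* With r = 0 the image of [D] lies in K, and injectivity of [subst] makes [D] constant. *)
have pos (r : nat) (D : {poly {mpoly K[n]}}) (c : {poly K}) :
    subst m g D = c%:MP * 'X_[g *+ r] -> size c = r.+1 -> ~ is_constant D ->
    (0 < r)%N.
  move=> sD szc ncD; rewrite lt0n; apply/eqP => r0; apply: ncD.
  exists c`_0; apply: (subst_inj m_gt0 (g := g)).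
  rewrite substC sD r0 mulm0n mpolyX0 mulr1.
  by rewrite [in LHS](@size1_polyC _ c) // szc r0.
have [p_gt0 q_gt0] := (pos _ _ _ sA sza ncA, pos _ _ _ sB szb ncB).
have copab := coprime_subst m_gt0 sA sza ga sB szb gb copAB.
have la0 : lead_coef a != 0 by rewrite lead_coef_eq0 -size_poly_gt0 sza.
(* As ab is monic, moving the scalar from [a] to [b] makes both factors monic, as the lifting
   requires. *)
pose a' := (lead_coef a)^-1 *: a; pose b' := lead_coef a *: b.
have a'b' : a' * b' = a * b.
  by rewrite -scalerAl -scalerAr scalerA mulVf ?scale1r.
have mon_a' : a' \is monic by apply/monicP; rewrite lead_coefZ mulVf.
have mon_b' : b' \is monic by rewrite -(monicMl _ mon_a') a'b'.
have above j c i ltjd := @associated_polyhedron_bound R K n d P gamma j c i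
  orthP d_gt0 ltjd.
have [|||||F [G [eP mF mG szF szG]]] :=
  coprime_factors_lift m_gt0 gE szP monP above pqd mon_a' mon_b' _ _ _ _ _
    (etrans a'b' eab).
- by rewrite size_scale ?invr_eq0.
- by rewrite size_scale.
- exact: gradedZ.
- exact: gradedZ.
- by rewrite coprimepZl ?invr_eq0 // coprimepZr.
by have [] := irrP F G eP; apply: monic_not_invertible; rewrite ?szF ?szG.
Qed.
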